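(* Let $\mathbf{H}\in\mathbb{R}^{n\times d}$ be the embedding matrix, with singular values $\sigma_1\ge\sigma_2\ge\cdots\ge\sigma_d\ge 0$. The Barlow Twins (BT) loss, the LogDet loss and the spectral contrastive loss (SCL), $$\mathcal{L}_{BT}=\sum_i(1-\mathcal{C}_{ii})^2+\lambda\sum_i\sum_{j\ne i}\mathcal{C}_{ij}^2,\qquad \mathcal{L}_{logdet}=\operatorname{Tr}(\Sigma)-\log\det(\Sigma),\qquad \mathcal{L}_{SCL}=\sum_i\sum_{j\neq i}(\mathbf{h}_i^T\mathbf{h}_j)^2,$$ are special cases of DirectSpec, i.e. of the Lagrangian $$\mathcal{L}=f(\sigma_1,\dots,\sigma_d)+\beta\left(\sqrt{\sum_i\sigma_i^2}-c\right),$$ with $f(\sigma_1,\dots,\sigma_d)=\sum_i(\sigma_i^2-1)^2$ for BT and SCL, and $f(\sigma_1,\dots,\sigma_d)=\sum_i\left(\sigma_i^2-2\log\sigma_i\right)$ for LogDet.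
   Context: The rows of $\mathbf{H}$ are the $d$-dimensional embeddings of the $n$ users and items of a recommender system; $\mathbf{h}_i\in\mathbb{R}^d$ is the $i$-th embedding (the $i$-th row of $\mathbf{H}$, written as a column vector). $\mathcal{C}_{ij}=\mathbf{H}[:,i]^T\mathbf{H}[:,j]$ is the inner product (called the covariance) of the $i$-th and $j$-th columns of $\mathbf{H}$, $\Sigma=\mathbf{H}^T\mathbf{H}$ is the covariance matrix, and $\lambda$ is the weight in the Barlow Twins loss. DirectSpec is the learning paradigm that balances the singular values of $\mathbf{H}$ through the displayed Lagrangian, where $f$ is a function of the singular values, $\beta$ is the multiplier, the singular values are bounded by the $L_2$ ball of radius $c$, and the minimum is to be reached at $\sigma_1=\cdots=\sigma_d=c/\sqrt d$. The authors call a loss a special case of DirectSpec with a given $f$ when the loss, rewritten in terms of the singular values, is $f$. In carrying out this rewriting they take $\mathbf{H}$ normalized column-wise for BT and row-wise for SCL.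
   Formalization: For normalized H the losses are not literally f: it is proved that L_BT = λ·f (λ > 0, unit columns), L_SCL = f + (n − d) (unit rows), and L_logdet = f; the minimum at σ_i = c/√d is over nonnegative σ of norm exactly c, not over the ball. *)

(* Defs.v *)
From HB Require Import structures.
From mathcomp Require Import all_boot all_order all_algebra.
From mathcomp Require Import all_classical all_reals all_analysis.

Set Implicit Arguments.
Unset Strict Implicit.
Unset Printing Implicit Defensive.

Import Order.TTheory GRing.Theory Num.Theory.

Local Open Scope ring_scope.

Section Embeddings.
Variables (R : realType) (n d : nat).
Implicit Types (H : 'M[R]_(n, d)) (sigma : 'I_d -> R).

Definition covariance_mx H : 'M[R]_d := H^T *m H.

(* The d singular values of H, in nonincreasing order: the nonnegative square
   roots of the eigenvalues of H^T H, counted with algebraic multiplicity.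
   Each H has exactly one such family; if n < d the last ones vanish. *)
Definition singular_values H sigma : Prop :=
  [/\ forall i j : 'I_d, (i <= j)%N -> sigma j <= sigma i,
      forall i, 0 <= sigma i &
      char_poly (covariance_mx H) = \prod_(i < d) ('X - (sigma i ^+ 2)%:P)].

Definition column_normalized H : Prop :=
  forall j, \sum_(k < n) H k j ^+ 2 = 1.

Definition row_normalized H : Prop :=
  forall k, \sum_(j < d) H k j ^+ 2 = 1.

Definition col_covariance H (i j : 'I_d) : R := ((col i H)^T *m col j H) 0 0.

Definition BT_loss (lam : R) H : \bar R :=
  (\sum_(i < d) (1 - col_covariance H i i) ^+ 2
   + lam * \sum_(i < d) \sum_(j < d | j != i) col_covariance H i j ^+ 2)%:E.

(* lne is -oo at 0, so this loss is +oo when the covariance matrix is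
   singular. *)
Definition logdet_loss H : \bar R :=
  ((\tr (covariance_mx H))%:E - lne (\det (covariance_mx H))%:E)%E.

Definition embedding H (i : 'I_n) : 'cV[R]_d := (row i H)^T.

Definition SCL_loss H : \bar R :=
  (\sum_(i < n) \sum_(j < n | j != i)
     (((embedding H i)^T *m embedding H j) 0 0) ^+ 2)%:E.

End Embeddings.

Section DirectSpec.
Variables (R : realType) (d : nat).
Implicit Types (f : ('I_d -> R) -> \bar R) (sigma : 'I_d -> R).

Definition l2norm sigma : R := Num.sqrt (\sum_(i < d) sigma i ^+ 2).

Definition directspec_lagrangian f (beta c : R) sigma : \bar R :=
  (f sigma + (beta * (l2norm sigma - c))%:E)%E.

(* beta multiplies an equality constraint, so the minimum of f is taken over
   the nonnegative vectors of L2 norm exactly c. *)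
Definition balanced_minimum f (c : R) : Prop :=
  forall sigma, (forall i, 0 <= sigma i) -> l2norm sigma = c ->
    (f (fun=> (c / Num.sqrt d%:R)%R) <= f sigma)%E.

Definition quartic_f sigma : \bar R := (\sum_(i < d) (sigma i ^+ 2 - 1) ^+ 2)%:E.

Definition logdet_f sigma : \bar R :=
  (\sum_(i < d) ((sigma i ^+ 2)%:E - 2%:E * lne (sigma i)%:E))%E.

End DirectSpec.

(* On the matrices satisfying normalized, the loss equals f up to a positive
   factor a and an additive constant b, neither depending on the matrix; hence
   it equals the Lagrangian wherever the norm constraint holds, for every
   multiplier. *)
Definition directspec_special_case (R : realType) (n d : nat)
    (f : ('I_d -> R) -> \bar R) (c a b : R)
    (normalized : 'M[R]_(n, d) -> Prop) (loss : 'M[R]_(n, d) -> \bar R) : Prop :=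
  [/\ 0 < a,
      balanced_minimum f c &
      forall (H : 'M[R]_(n, d)) (sigma : 'I_d -> R),
        normalized H -> singular_values H sigma ->
        loss H = (a%:E * f sigma + b%:E)%E /\
        (l2norm sigma = c -> forall beta : R,
           loss H = (a%:E * directspec_lagrangian f beta c sigma + b%:E)%E)].

Definition forces_l2norm (R : realType) (n d : nat)
    (normalized : 'M[R]_(n, d) -> Prop) (c : R) : Prop :=
  forall (H : 'M[R]_(n, d)) (sigma : 'I_d -> R),
    normalized H -> singular_values H sigma -> l2norm sigma = c.

(* Main.v *)
(* The characteristic polynomial of H^T H gives its trace and determinant, hence
   the LogDet loss; that of its square gives
   sum_i sigma_i^4 = tr ((H^T H)^2) = tr ((H H^T)^2), the sum of the squared
   entries of either Gram matrix. Under the corresponding normalization the Gram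
   diagonal is 1, so the BT and SCL losses are affine functions of this sum.
   Both f have the form sum_i phi (sigma_i^2) with phi convex, so on the sphere
   of radius c the tangent line of phi at c^2/d shows that the balanced point is
   a minimizer. *)
Require Import Defs.
From HB Require Import structures.
From mathcomp Require Import all_boot all_order all_algebra.
From mathcomp Require Import all_classical all_reals all_analysis.
From mathcomp Require Import ring lra.

Set Implicit Arguments.
Unset Strict Implicit.
Unset Printing Implicit Defensive.

Import Order.TTheory GRing.Theory Num.Theory.

Local Open Scope ring_scope.

(** * Characteristic polynomials that split into linear factors *)

Lemma mxtrace_char_poly_split (R : comNzRingType) d (A : 'M[R]_d) (s : 'I_d -> R) :
  char_poly A = \prod_(i < d) ('X - (s i)%:P) -> \tr A = \sum_(i < d) s i.
Proof.
(* [char_poly_trace] reads the coefficient of degree [d - 1], so it requires a positive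
   dimension. *)
case: d A s => [|d] A s splitA; first by rewrite /mxtrace !big_ord0.
have szs : size [seq s i | i <- enum 'I_d.+1] = d.+1.
  by rewrite size_map size_enum_ord.
have := char_poly_trace A isT; rewrite splitA.
rewrite -big_enum -(big_map s xpredT (fun p => 'X - p%:P)).
have := @coefPn_prod_XsubC _ [seq s i | i <- enum 'I_d.+1]; rewrite szs => -> //.
by rewrite big_map big_enum => /oppr_inj.
Qed.

Lemma det_char_poly_split (R : comNzRingType) d (A : 'M[R]_d) (s : 'I_d -> R) :
  char_poly A = \prod_(i < d) ('X - (s i)%:P) -> \det A = \prod_(i < d) s i.
Proof.
move=> splitA; have := char_poly_det A; rewrite splitA.
rewrite -big_enum -(big_map s xpredT (fun p => 'X - p%:P)) coef0_prod_XsubC.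
rewrite size_map size_enum_ord big_map big_enum /=.
by move/(congr1 ( *%R ((-1) ^+ d))); rewrite !mulrA -expr2 sqrr_sign !mul1r.
Qed.

(** The coefficient of [p] at [i] is that of [p \Po 'X^n] at [i * n]. Characteristic polynomials can
    thus be compared after substituting $X^2$. *)
Lemma comp_poly_Xn_inj (R : nzRingType) n :
  (0 < n)%N -> injective (fun p : {poly R} => p \Po 'X^n).
Proof.
move=> n0 p q pq; apply/polyP => i; have /polyP/(_ (i * n)%N) := pq.
by rewrite !coef_comp_poly_Xn // dvdn_mull // mulnK.
Qed.

(** Substitution is a ring morphism, so it commutes with the determinant. *)
Lemma char_poly_comp (R : comNzRingType) d (A : 'M[R]_d) (q : {poly R}) :
  char_poly A \Po q = \det (q%:M - map_mx polyC A).
Proof.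
rewrite /char_poly -[LHS]/((comp_poly q) _) -det_map_mx; congr (\det _).
by apply/matrixP=> i j; rewrite !mxE rmorphB /= rmorphMn /= comp_polyX comp_polyC.
Qed.

(* det(X^2 - A^2) = det(X - A) det(X + A) *)
Lemma char_poly_sqr (R : comNzRingType) d (A : 'M[R]_d) :
  char_poly (A *m A) \Po 'X^2 =
  (-1) ^+ d * (char_poly A * (char_poly A \Po - 'X)).
Proof.
rewrite mulrCA {2}[char_poly A]/char_poly.
(* The sign is absorbed into the second determinant, turning $-X - A$ into $X + A$. *)
rewrite !char_poly_comp -detZ -det_mulmx; congr (\det _).
rewrite scaleN1r opprB raddfN opprK /char_poly_mx.
rewrite mulmxDr !mulmxBl map_mxM /= -scalar_mxM -expr2.
by rewrite (scalar_mxC _ (map_mx _ _)) [RHS]addrC addrA subrK.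
Qed.

(** After substituting $X^2$, each factor is $X^2 - s_i^2 = (X - s_i)(X + s_i)$. *)
Lemma char_poly_sqr_split (R : comNzRingType) d (A : 'M[R]_d) (s : 'I_d -> R) :
  char_poly A = \prod_(i < d) ('X - (s i)%:P) ->
  char_poly (A *m A) = \prod_(i < d) ('X - (s i ^+ 2)%:P).
Proof.
move=> splitA; apply: (@comp_poly_Xn_inj _ 2) => //=.
rewrite char_poly_sqr splitA !rmorph_prod /= mulrCA.
(* The power $(-1)^d$ is spread as one sign per factor. *)
rewrite -[X in _ ^+ X](card_ord d) -prodrN -big_split /=.
apply: eq_bigr => i _; rewrite !rmorphB /= !comp_polyX !comp_polyC.
by rewrite rmorphXn /=; ring.
Qed.

(** * Trace and determinant of the covariance matrix *)

Section SingularValues.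
Variables (R : realType) (n d : nat) (H : 'M[R]_(n, d)) (sigma : 'I_d -> R).
Hypothesis Hsigma : singular_values H sigma.

Lemma mxtrace_covariance : \tr (covariance_mx H) = \sum_(i < d) sigma i ^+ 2.
Proof. by case: Hsigma => _ _ /mxtrace_char_poly_split. Qed.

Lemma mxtrace_covariance_sqr :
  \tr (covariance_mx H *m covariance_mx H) = \sum_(i < d) sigma i ^+ 4.
Proof.
case: Hsigma => _ _ /char_poly_sqr_split/mxtrace_char_poly_split ->.
by apply: eq_bigr => i _; rewrite -exprM.
Qed.

Lemma det_covariance : \det (covariance_mx H) = \prod_(i < d) sigma i ^+ 2.
Proof. by case: Hsigma => _ _ /det_char_poly_split. Qed.

(** Turns the norm constraint into a trace condition, which either normalization settles. *)
Lemma l2norm_sqrt_trace : l2norm sigma = Num.sqrt (\tr (covariance_mx H)).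
Proof. by rewrite mxtrace_covariance. Qed.

End SingularValues.

(** * The losses as functions of the singular values *)

Lemma quartic_fE (R : realType) d (sigma : 'I_d -> R) :
  quartic_f sigma = (\sum_(i < d) sigma i ^+ 4
                     - 2 * \sum_(i < d) sigma i ^+ 2 + d%:R)%:E.
Proof.
have -> : d%:R = \sum_(i < d) 1 :> R by rewrite sumr_const card_ord.
congr EFin; rewrite mulr_sumr -sumrB -big_split.
by apply: eq_bigr => i _ /=; ring.
Qed.

Lemma sum_row_offdiag (R : comNzRingType) d (f : 'I_d -> 'I_d -> R) :
  \sum_(i < d) \sum_(j < d | j != i) f i j =
  \sum_(i < d) \sum_(j < d) f i j - \sum_(i < d) f i i.
Proof.
by rewrite -sumrB; apply: eq_bigr => i _; rewrite [in RHS](bigD1 i) //= addrC addrK.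
Qed.

Lemma sum_sqr_sym_mx (R : comNzRingType) d (A : 'M[R]_d) :
  A^T = A -> \sum_(i < d) \sum_(j < d) A i j ^+ 2 = \tr (A *m A).
Proof.
move=> symA; rewrite /mxtrace; apply: eq_bigr => i _; rewrite mxE; apply: eq_bigr => j _.
by rewrite expr2 -[in A j i]symA mxE.
Qed.

Lemma col_covarianceE (R : realType) n d (H : 'M[R]_(n, d)) i j :
  col_covariance H i j = covariance_mx H i j.
Proof. by rewrite /col_covariance !mxE; apply: eq_bigr => k _; rewrite !mxE. Qed.

Lemma embedding_gram (R : realType) n d (H : 'M[R]_(n, d)) i j :
  ((embedding H i)^T *m embedding H j) 0 0 = (H *m H^T) i j.
Proof. by rewrite !mxE; apply: eq_bigr => k _; rewrite !mxE. Qed.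

Lemma covariance_diag (R : realType) n d (H : 'M[R]_(n, d)) i :
  covariance_mx H i i = \sum_(k < n) H k i ^+ 2.
Proof. by rewrite mxE; apply: eq_bigr => k _; rewrite mxE expr2. Qed.

Lemma gram_diag (R : realType) n d (H : 'M[R]_(n, d)) i :
  (H *m H^T) i i = \sum_(k < d) H i k ^+ 2.
Proof. by rewrite mxE; apply: eq_bigr => k _; rewrite mxE expr2. Qed.

Lemma column_normalized_trace (R : realType) n d (H : 'M[R]_(n, d)) :
  column_normalized H -> \tr (covariance_mx H) = d%:R.
Proof.
move=> Hn; rewrite /mxtrace (eq_bigr (fun=> 1)) => [|i _].
  by rewrite sumr_const card_ord.
by rewrite covariance_diag Hn.
Qed.

Lemma row_normalized_trace (R : realType) n d (H : 'M[R]_(n, d)) :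
  row_normalized H -> \tr (covariance_mx H) = n%:R.
Proof.
move=> Hn; rewrite mxtrace_mulC /mxtrace (eq_bigr (fun=> 1)) => [|i _].
  by rewrite sumr_const card_ord.
by rewrite gram_diag Hn.
Qed.

(** As the trace is $d$, [quartic_f] is $\sum_i \sigma_i^4 - 2d + d$, exactly the off-diagonal
    sum. *)
Lemma BT_loss_quartic (R : realType) n d (lam : R) (H : 'M[R]_(n, d)) sigma :
  column_normalized H -> singular_values H sigma ->
  BT_loss lam H = (lam%:E * quartic_f sigma)%E.
Proof.
move=> Hn Hs; rewrite quartic_fE -(mxtrace_covariance_sqr Hs).
rewrite -(mxtrace_covariance Hs) (column_normalized_trace Hn) -EFinM.
have diag i : col_covariance H i i = 1 by rewrite col_covarianceE covariance_diag Hn.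
congr EFin; rewrite sum_row_offdiag big1 => [|i _]; last by rewrite diag subrr expr0n.
rewrite [X in _ - X](eq_bigr (fun=> 1)) => [|i _]; last by rewrite diag expr1n.
rewrite sumr_const card_ord -sum_sqr_sym_mx ?trmx_mul ?trmxK //.
under eq_bigr do under eq_bigr do rewrite col_covarianceE.
by rewrite add0r; congr (_ * _); ring.
Qed.

(** As the trace is $n$, the off-diagonal sum $\sum_i \sigma_i^4 - n$ exceeds [quartic_f], which is
    $\sum_i \sigma_i^4 - 2n + d$, by $n - d$. *)
Lemma SCL_loss_quartic (R : realType) n d (H : 'M[R]_(n, d)) sigma :
  row_normalized H -> singular_values H sigma ->
  SCL_loss H = (quartic_f sigma + (n%:R - d%:R)%:E)%E.
Proof.
move=> Hn Hs; rewrite quartic_fE -(mxtrace_covariance_sqr Hs).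
rewrite -(mxtrace_covariance Hs) (row_normalized_trace Hn) -EFinD.
congr EFin; rewrite sum_row_offdiag.
rewrite [X in _ - X = _](eq_bigr (fun=> 1)) => [|i _]; last first.
  by rewrite embedding_gram gram_diag Hn expr1n.
have -> : \sum_(i < n) \sum_(j < n)
    (((embedding H i)^T *m embedding H j) 0 0) ^+ 2 =
    \tr (covariance_mx H *m covariance_mx H).
  under eq_bigr do under eq_bigr do rewrite embedding_gram.
  rewrite sum_sqr_sym_mx ?trmx_mul ?trmxK //.
  (* Cyclicity of the trace passes from $H H^T$ to $H^T H$. *)
  by rewrite -mulmxA mxtrace_mulC /covariance_mx !mulmxA.
by rewrite sumr_const card_ord; ring.
Qed.

(* If some a i vanishes, both sides are +oo, since lne 0 = -oo. *)
Lemma sum_sub_lne_prod (R : realType) (I : finType) (a : I -> R) :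
  (forall i, 0 <= a i) ->
  ((\sum_i a i)%:E - lne (\prod_i a i)%:E = \sum_i ((a i)%:E - lne (a i)%:E))%E.
Proof.
(* The induction carries the sign of the partial product, so that it is either zero or positive. *)
move=> a0; suff [] : 0 <= \prod_i a i /\
  ((\sum_i a i)%:E - lne (\prod_i a i)%:E = \sum_i ((a i)%:E - lne (a i)%:E))%E by [].
apply: (big_rec3 (fun s p t => 0 <= p /\ (s%:E - lne p%:E = t)%E)).
  by rewrite lne1 sube0 ler01.
move=> i s p t _ [p0 <-]; split; first exact: mulr_ge0.
have := a0 i; rewrite le_eqVlt => /predU1P[<-|ai_gt0].
  by rewrite mul0r /= lexx; case: ifP.
move: p0; rewrite le_eqVlt => /predU1P[<-|p_gt0].
  by rewrite mulr0 /= lexx leNgt ai_gt0.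
by rewrite !lne_EFin ?mulr_gt0 // lnM //= -!EFinB -EFinD; congr EFin; ring.
Qed.

Lemma logdet_loss_f (R : realType) n d (H : 'M[R]_(n, d)) sigma :
  singular_values H sigma -> logdet_loss H = logdet_f sigma.
Proof.
move=> Hs; rewrite /logdet_loss (mxtrace_covariance Hs) (det_covariance Hs).
rewrite sum_sub_lne_prod => [|i]; last exact: sqr_ge0.
apply: eq_bigr => i _; congr (_ - _)%E; case: Hs => _ /(_ i) + _.
(* At a zero singular value both logarithms are $-\infty$. *)
rewrite le_eqVlt => /predU1P[<-|s_gt0].
  by rewrite expr0n /= lexx gt0_muleNy.
by rewrite !lne_EFin ?exprn_gt0 // lnXn // -EFinM mulr_natl.
Qed.

(** * Minimality of the balanced point *)

Section BalancedMinimum.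
Variables (R : realType) (d : nat).
Implicit Types (g : R -> \bar R) (sigma : 'I_d -> R).

Lemma l2norm_ge0 sigma : 0 <= l2norm sigma.
Proof. exact: sqrtr_ge0. Qed.

Lemma sqr_l2norm sigma : l2norm sigma ^+ 2 = \sum_(i < d) sigma i ^+ 2.
Proof. by rewrite sqr_sqrtr // sumr_ge0 // => i _; exact: sqr_ge0. Qed.

(* Summing the tangent-line bound of g, as a function of the square, over a
   vector of norm c leaves no linear term. *)
Lemma balanced_minimum_sum g (c k : R) :
  (forall x : R, 0 <= x ->
     (g (c / Num.sqrt d%:R)%R + (k * (x ^+ 2 - (c / Num.sqrt d%:R) ^+ 2))%:E
      <= g x)%E) ->
  balanced_minimum (fun sigma => \sum_(i < d) g (sigma i))%E c.
Proof.
move=> tangent sigma sigma0 sigmac.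
have lin0 : \sum_(i < d) k * (sigma i ^+ 2 - (c / Num.sqrt d%:R) ^+ 2) = 0.
  have [d0|d0] := posnP d.
    by apply: big1 => i; have := ltn_ord i; rewrite [X in (_ < X)%N]d0.
  rewrite -mulr_sumr sumrB -sqr_l2norm sigmac sumr_const card_ord.
  rewrite expr_div_n sqr_sqrtr ?ler0n // -[X in _ - X]mulr_natr divfK ?pnatr_eq0 -?lt0n //.
  by rewrite subrr mulr0.
rewrite -[leLHS]adde0 -[X in (_ + X)%E]/(0%:E) -lin0 -sumEFin -big_split /=.
by apply: lee_sum => i _; exact: tangent.
Qed.

Lemma quartic_balanced_minimum c : balanced_minimum (@quartic_f R d) c.
Proof.
have -> : @quartic_f R d = (fun sigma =>
    \sum_(i < d) ((sigma i ^+ 2 - 1) ^+ 2)%:E)%E.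
  by apply/funext => sigma; rewrite sumEFin.
set m := c / Num.sqrt d%:R.
(* The slope is the derivative of $(y - 1)^2$ at $y = m^2$; the gap to the tangent is $(x^2 -
   m^2)^2$. *)
apply: (@balanced_minimum_sum (fun x => ((x ^+ 2 - 1) ^+ 2)%:E) _
  (2 * (m ^+ 2 - 1))) => x _.
rewrite -EFinD lee_fin -/m -subr_ge0.
by rewrite (_ : _ - _ = (x ^+ 2 - m ^+ 2) ^+ 2) ?sqr_ge0 //; ring.
Qed.

(** The tangent of $y - \log y$ at $m^2$ has slope $1 - m^{-2}$; the bound is $\log q \le q - 1$ at
    $q = (x/m)^2$. *)
Lemma logdet_tangent (m x : R) : 0 < m -> 0 <= x ->
  ((m ^+ 2)%:E - 2%:E * lne m%:E + ((1 - m ^- 2) * (x ^+ 2 - m ^+ 2))%:E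
   <= (x ^+ 2)%:E - 2%:E * lne x%:E)%E.
Proof.
move=> m0; rewrite le_eqVlt => /predU1P[<-|x0].
  (* At $x = 0$ the right side is $+\infty$. *)
  by rewrite [lne 0]/= lexx gt0_muleNy ?lte_fin // leey.
rewrite !lne_EFin // -!EFinM -!EFinB -EFinD lee_fin.
have xm0 : 0 < (x / m) ^+ 2 by rewrite exprn_gt0 ?divr_gt0.
have : ln (1 + ((x / m) ^+ 2 - 1)) <= (x / m) ^+ 2 - 1.
  by apply: le_ln1Dx; rewrite ltrBrDr addNr.
rewrite addrC subrK lnXn ?divr_gt0 // ln_div ?posrE // -mulr_natl expr_div_n.
rewrite mulrBl mul1r mulrBr mulVf ?expf_neq0 ?gt_eqF // [m ^- 2 * _]mulrC.
by move: (_ / _) => q; lra.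
Qed.

Lemma logdet_balanced_minimum c : balanced_minimum (@logdet_f R d) c.
Proof.
have [d0|d0] := posnP d.
  move: (@logdet_f R d); rewrite d0 => f sigma _ _.
  suff -> : sigma = (fun=> c / Num.sqrt 0%:R) by [].
  by apply/funext => -[].
(* The tangent requires $c > 0$. No vector has negative norm, and only the zero vector, itself
   balanced, has norm 0. *)
have [c0|c0|<-] := ltgtP 0 c; last 2 first.
- by move=> sigma _ /esym sigmac; move: c0; rewrite sigmac ltNge l2norm_ge0.
- move=> sigma _ sigma_eq0; suff -> : sigma = (fun=> 0 / Num.sqrt d%:R) by [].
  apply/funext => i; rewrite mul0r; apply/eqP; rewrite -sqrf_eq0.
  have /eqP := sqr_l2norm sigma; rewrite sigma_eq0 expr0n eq_sym.
  rewrite psumr_eq0 => [/allP/(_ i)|j _]; last exact: sqr_ge0.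
  by rewrite mem_index_enum => /(_ isT).
apply: (@balanced_minimum_sum (fun x => (x ^+ 2)%:E - 2%:E * lne x%:E)%E c
  (1 - (c / Num.sqrt d%:R) ^- 2)) => x.
by apply: logdet_tangent; rewrite divr_gt0 // sqrtr_gt0 ltr0n.
Qed.

End BalancedMinimum.

(** * From loss identities to the Lagrangian *)

Lemma special_case_of_lossE (R : realType) n d (f : ('I_d -> R) -> \bar R)
    (c a b : R) (normalized : 'M[R]_(n, d) -> Prop) loss :
  0 < a -> balanced_minimum f c ->
  (forall H sigma, normalized H -> singular_values H sigma ->
     loss H = (a%:E * f sigma + b%:E)%E) ->
  directspec_special_case f c a b normalized loss.
Proof.
move=> a0 fmin lossE; split=> // H sigma Hn Hs; split; first exact: lossE.
(* On the constraint the multiplier term vanishes for every [beta]. *)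
move=> sigmac beta; rewrite /directspec_lagrangian sigmac subrr mulr0 adde0.
exact: lossE.
Qed.

(** The radii $\sqrt d$ and $\sqrt n$ are the square roots of the traces fixed by the
    normalizations; LogDet has no normalization, so its [c] is arbitrary. *)
Theorem proposition6 (R : realType) (n d : nat) :
  (forall lam : R, 0 < lam ->
     directspec_special_case (@quartic_f R d) (Num.sqrt d%:R) lam 0
       (@column_normalized R n d) (@BT_loss R n d lam) /\
     forces_l2norm (@column_normalized R n d) (Num.sqrt d%:R)) /\
  (forall c : R,
     directspec_special_case (@logdet_f R d) c 1 0
       (fun _ : 'M[R]_(n, d) => True) (@logdet_loss R n d)) /\
  (directspec_special_case (@quartic_f R d) (Num.sqrt n%:R) 1 (n%:R - d%:R)
     (@row_normalized R n d) (@SCL_loss R n d) /\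
   forces_l2norm (@row_normalized R n d) (Num.sqrt n%:R)).
Proof.
split; [move=> lam lam0; split | split; [move=> c | split]].
- apply: special_case_of_lossE => // [|H sigma Hn Hs].
    exact: quartic_balanced_minimum.
  by rewrite adde0; exact: BT_loss_quartic.
- by move=> H sigma Hn Hs; rewrite (l2norm_sqrt_trace Hs) column_normalized_trace.
- apply: special_case_of_lossE => // [|H sigma _ Hs].
    exact: logdet_balanced_minimum.
  by rewrite adde0 mul1e; exact: logdet_loss_f.
- apply: special_case_of_lossE => // [|H sigma Hn Hs].
    exact: quartic_balanced_minimum.
  by rewrite mul1e; exact: SCL_loss_quartic.
- by move=> H sigma Hn Hs; rewrite (l2norm_sqrt_trace Hs) row_normalized_trace.
Qed.
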